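(* Let $E$ and $F$ be two ordered Banach spaces, where the positive cone $E_{+}$ has nonempty interior $E_{++}$. Let $\Phi:E_{+}\rightarrow F$ be a continuous function that is differentiable on $E_{++}$. Then: (i) $\Phi$ is strongly subadditive if and only if $\Phi(\mathbf{0})\geq 0$ and the differential $d\Phi$ is nonincreasing as a map from $E_{++}$ into $L(E,F)$, that is, $\mathbf{u}\leq\mathbf{v}$ in $E_{++}$ implies $d\Phi(\mathbf{v})\leq d\Phi(\mathbf{u})$; (ii) $\Phi$ is strongly superadditive if and only if $\Phi(\mathbf{0})\leq 0$ and the differential $d\Phi$ is nondecreasing as a map from $E_{++}$ into $L(E,F)$, that is, $\mathbf{u}\leq\mathbf{v}$ in $E_{++}$ implies $d\Phi(\mathbf{u})\leq d\Phi(\mathbf{v})$.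
   Context: An ordered Banach space is a real Banach space $E$ together with a closed convex cone $E_{+}\subset E$ (the positive cone) such that $E_{+}\cap(-E_{+})=\{0\}$, with the order $x\leq y$ iff $y-x\in E_{+}$, which satisfies: (OBS1) $E=E_{+}-E_{+}$; (OBS2) $0\leq x\leq y$ implies $\|x\|\leq\|y\|$. $E_{++}$ denotes the interior of $E_{+}$. $L(E,F)$ is the space of bounded linear operators from $E$ to $F$, ordered by: $S\leq T$ iff $S(\mathbf{w})\leq T(\mathbf{w})$ in $F$ for all $\mathbf{w}\in E_{+}$. Differentiable means Fréchet differentiable, with differential $d\Phi(\mathbf{u})\in L(E,F)$ at $\mathbf{u}\in E_{++}$. A function $\Phi:E_{+}\to F$ is strongly subadditive if, in the order of $F$, $\Phi(\mathbf{x}+\mathbf{y})\leq\Phi(\mathbf{x})+\Phi(\mathbf{y})$ for all $\mathbf{x},\mathbf{y}\in E_{+}$ and $\Phi(\mathbf{x}+\mathbf{y}+\mathbf{z})+\Phi(\mathbf{z})\leq\Phi(\mathbf{x}+\mathbf{z})+\Phi(\mathbf{y}+\mathbf{z})$ for all $\mathbf{x},\mathbf{y},\mathbf{z}\in E_{+}$. It is strongly superadditive if $-\Phi$ is strongly subadditive. *)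

(* Defs.v *)
From HB Require Import structures.
From mathcomp Require Import all_boot all_order all_algebra.
From mathcomp Require Import all_classical all_reals all_analysis.

Set Implicit Arguments.
Unset Strict Implicit.
Unset Printing Implicit Defensive.

Import Order.TTheory GRing.Theory Num.Theory.
Import numFieldNormedType.Exports.

Local Open Scope classical_set_scope.
Local Open Scope ring_scope.

Record orderedBanach (R : realType) := OrderedBanach {
  obs_space :> completeNormedModType R;
  pos : set obs_space;
  pos_closed : closed pos;
  pos_convex : convex_set pos;
  pos0 : pos 0;
  posZ : forall (t : R) (x : obs_space), 0 <= t -> pos x -> pos (t *: x);
  pos_pointed : forall x : obs_space, pos x -> pos (- x) -> x = 0;
  pos_generating : forall x : obs_space,
    exists y z : obs_space, [/\ pos y, pos z & x = y - z];
  pos_norm_le : forall x y : obs_space,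
    pos x -> pos (y - x) -> `|x| <= `|y|
}.

Arguments pos {R} E : rename.

Definition cone_le (R : realType) (E : orderedBanach R) (x y : E) : Prop :=
  pos E (y - x).

Notation "x <=c y" := (cone_le x y) (at level 70, no associativity).

(* The order of L(E, F).  It only looks at the underlying linear map, so no
   type of bounded operators is introduced: below it is applied to 'd Phi u
   with Phi differentiable at u, which includes continuity of 'd Phi u. *)
Definition op_le (R : realType) (E F : orderedBanach R)
    (S T : {linear E -> F}) : Prop :=
  forall w : E, pos E w -> S w <=c T w.

(* A map E_+ -> F is represented by a total map E -> F of which only the
   values on the cone are used. *)
Definition strongly_subadditive (R : realType) (E F : orderedBanach R)
    (Phi : E -> F) : Prop :=
  (forall x y : E, pos E x -> pos E y -> Phi (x + y) <=c Phi x + Phi y) /\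
  (forall x y z : E, pos E x -> pos E y -> pos E z ->
     Phi (x + y + z) + Phi z <=c Phi (x + z) + Phi (y + z)).

Definition strongly_superadditive (R : realType) (E F : orderedBanach R)
    (Phi : E -> F) : Prop :=
  strongly_subadditive (fun x => - Phi x).

(* Main.v *)
(* Strong subadditivity at (v - u, t w, u) compares the difference quotients of
   Phi at u and v in the direction w.  Conversely, Phi z - Phi (x + z) has a
   positive derivative along y when z is interior, and the mean value inequality
   for a closed convex cone gives the second condition; a limit z + h e -> z
   with e interior extends it to the whole cone, and z = 0 with Phi 0 >= 0 gives
   the first condition. *)
Require Import Defs.
From HB Require Import structures.
From mathcomp Require Import all_boot all_order all_algebra.
From mathcomp Require Import all_classical all_reals all_analysis.
From mathcomp Require Import ring lra.

Import Order.TTheory GRing.Theory Num.Theory.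
Import numFieldNormedType.Exports.

Local Open Scope classical_set_scope.
Local Open Scope ring_scope.

(** The little-o in the first-order expansion along [v], unfolded into an explicit error bound. *)
Lemma derivable_approx {R : numFieldType} {V W : normedModType R}
    {f : V -> W} {a v : V} {eta : R} : derivable f a v -> 0 < eta ->
  \forall h \near 0, `|f (a + h *: v) - f a - h *: 'D_v f a| <= eta * `|h|.
Proof.
move=> /derivable_nbhs/eqaddoP df eta0.
apply: filterS (df _ eta0) => h.
rewrite opprD -![(_ + _ : _ -> _) _]/(_ + _) -![(- _ : _ -> _) _]/(- _) /=.
by rewrite [h *: v + a]addrC addrA.
Qed.

(** Both difference quotients are the same function of [h]. Serves to differentiate [Phi (x + w)] in
    [w]. *)
Lemma is_derive_shift (R : numFieldType) (V W : normedModType R)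
    (f : V -> W) (x a v : V) (df : W) :
  is_derive (x + a) v f df -> is_derive a v (fun w => f (x + w)) df.
Proof.
have q : (fun h : R => h^-1 *: (((fun w => f (x + w)) \o shift a) (h *: v) -
    f (x + a))) =
    (fun h : R => h^-1 *: ((f \o shift (x + a)) (h *: v) - f (x + a))).
  by apply/funext => h /=; rewrite addrCA.
by move=> [df1 df2]; split; rewrite /derivable /derive q.
Qed.

(** * Sums, limits and interior points of the positive cone *)

Section Cone.
Context {R : realType} {E : orderedBanach R}.
Implicit Types x y u w : E.

(** Convexity puts the midpoint of [x] and [y] in the cone, and doubling keeps it there. *)
Lemma posD x y : pos E x -> pos E y -> pos E (x + y).
Proof.
move=> px py.
have : pos E (2^-1 *: x + (1 - 2^-1) *: y).
  have h01 : 0 <= 2^-1 :> R by lra.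
  have h1 : 2^-1 <= 1 :> R by lra.
  by have /set_mem := @pos_convex R E x y (Itv01 h01 h1) (mem_set px) (mem_set py).
move=> /(posZ (ler0n R 2)); rewrite scalerDr !scalerA.
have -> : (2 * 2^-1 : R) = 1 by lra.
have -> : (2 * (1 - 2^-1) : R) = 1 by lra.
by rewrite !scale1r.
Qed.

Lemma pos_approx w :
  (forall eta : R, 0 < eta -> exists2 c, pos E c & `|w - c| <= eta) -> pos E w.
Proof.
move=> H; apply: pos_closed => B /nbhs_normP[e /= e0 eB].
have [c pc wc] := H (e / 2) (divr_gt0 e0 (ltr0n R 2)).
exists c; split=> //; apply: eB => /=.
by apply: le_lt_trans wc _; rewrite ltr_pdivrMr// ltr_pMr// ltr1n.
Qed.

Lemma pos_cvg_right (g : R -> E) w : (forall h, 0 < h -> pos E (g h)) ->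
  g h @[h --> 0^'+] --> w -> pos E w.
Proof.
move=> pg; apply: closed_cvg => //; first exact: pos_closed.
near=> h; apply: pg; near: h; exact: nbhs_right_gt.
Unshelve. all: by end_near. Qed.

(** Translation by [- x] is continuous, so it sends a neighbourhood of [x + u] into the cone; adding
    [x] back stays in the cone. *)
Lemma interior_posD x u : pos E x -> (pos E)° u -> (pos E)° (x + u).
Proof.
move=> px pu.
have c : (w - x) @[w --> x + u] --> u.
  rewrite -[X in _ --> X](addrK x) [u + x]addrC.
  by apply: cvgB; [exact: cvg_id|exact: cvg_cst].
have := c _ pu; rewrite nbhs_simpl /=; apply: filterS => w /= pw.
by rewrite -(subrK x w); exact: posD.
Qed.

Lemma interior_posZ (t : R) u : 0 < t -> (pos E)° u -> (pos E)° (t *: u).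
Proof.
move=> t0 pu.
have c : (t^-1 *: w) @[w --> t *: u] --> u.
  rewrite -[X in _ --> X](scalerK (lt0r_neq0 t0)).
  by apply: cvgZl_tmp; exact: cvg_id.
have := c _ pu; rewrite nbhs_simpl /=; apply: filterS => w /= pw.
by rewrite -(scalerKV (lt0r_neq0 t0) w); apply: posZ => //; exact: ltW.
Qed.

(** The ray stays in the cone for [h > 0], so continuity relative to the cone suffices for the
    one-sided limit. *)
Lemma within_pos_cvg_ray (T : topologicalType) (f : E -> T) x y :
  {within pos E, continuous f} -> pos E x -> pos E y ->
  f (x + h *: y) @[h --> 0^'+] --> f x.
Proof.
move=> /subspace_continuousP/(_ x) + px py => /(_ px) fx.
apply: (cvg_comp (fun h : R => x + h *: y) f _ fx).
have c0 : x + h *: y @[h --> 0^'+] --> x + (0 : R) *: y.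
  apply: cvg_at_right_filter.
  by apply: cvgD; [exact: cvg_cst|apply: cvgZr_tmp; exact: cvg_id].
rewrite scale0r addr0 in c0.
move=> A /c0; rewrite !nbhs_simpl /= => cA.
near=> h.
have h0 : 0 <= h by apply: ltW; near: h; exact: nbhs_right_gt.
have : pos E (x + h *: y) by apply: posD => //; exact: posZ.
by near: h.
Unshelve. all: by end_near. Qed.

End Cone.

(** * A mean value inequality for a closed convex cone *)

Section MeanValue.
Context {R : realType} {E : normedModType R} {F : orderedBanach R}.

(* Segments on which the increment of g is almost positive can be concatenated,
   and differentiability makes every short enough segment of this kind; a
   supremum argument then reaches the whole of [0, 1]. *)
Lemma pos_increment (f : E -> F) (z y : E) :
  (forall t : R, 0 <= t <= 1 -> derivable f (z + t *: y) y) ->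
  (forall t : R, 0 <= t <= 1 -> pos F ('D_y f (z + t *: y))) ->
  pos F (f (z + y) - f z).
Proof.
move=> df Df; apply: pos_approx => eta eta0.
pose g (t : R) := f (z + t *: y).
(* The error allowed is proportional to the length of the segment, so that errors add up exactly
   under concatenation. *)
pose good (a b : R) := exists2 c, pos F c & `|g b - g a - c| <= eta * (b - a).
have good_trans a b c : good a b -> good b c -> good a c.
  move=> [p pp gp] [q pq gq]; exists (p + q); first exact: posD.
  have -> : g c - g a - (p + q) = (g b - g a - p) + (g c - g b - q).
    by rewrite [RHS]addrACA -opprD [g b - g a + _]addrC addrA subrK.
  apply: le_trans (ler_normD _ _) _.
  have -> : eta * (c - a) = eta * (b - a) + eta * (c - b) by ring.
  exact: lerD.
(* The segment must straddle [t]: the expansions at [t] towards [a] and towards [b] then have errors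
   summing to [eta * (b - a)]. *)
have local t : 0 <= t <= 1 -> exists2 d : R, 0 < d &
    forall a b, t - d < a -> a <= t -> t <= b -> b < t + d -> good a b.
  move=> t01.
  have /nbhs_normP[d /= d0 dP] := derivable_approx (df t t01) eta0.
  exists d => // a b ta at_ tb bt.
  have ga : `|g a - g t - (a - t) *: 'D_y f (z + t *: y)| <= eta * (t - a).
    have := dP (a - t).
    rewrite /= sub0r normrN [`|a - t|]distrC ger0_norm ?subr_ge0//.
    rewrite -[z + _ + _]addrA -scalerDl subrKC; apply; lra.
  have gb : `|g b - g t - (b - t) *: 'D_y f (z + t *: y)| <= eta * (b - t).
    have := dP (b - t); rewrite /= sub0r normrN ger0_norm ?subr_ge0//.
    rewrite -[z + _ + _]addrA -scalerDl subrKC; apply; lra.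
  exists ((b - a) *: 'D_y f (z + t *: y)).
    by apply: posZ; [lra|exact: Df].
  set D := 'D_y f _ in ga gb *.
  have -> : g b - g a - (b - a) *: D =
      (g b - g t - (b - t) *: D) - (g a - g t - (a - t) *: D).
    rewrite opprD opprK opprB addrACA [g b - g t + _]addrA subrK.
    rewrite -!scaleNr -scalerDl.
    by congr (_ + _ *: _); ring.
  apply: le_trans (ler_normB _ _) _.
  have -> : eta * (b - a) = eta * (b - t) + eta * (t - a) by ring.
  exact: lerD.
suff [c pc gc] : good 0 1.
  by exists c => //; move: gc; rewrite /g scale0r scale1r addr0 subr0 mulr1.
pose S := [set t : R | 0 <= t <= 1 /\ good 0 t].
have S0 : S 0.
  split; first by rewrite lexx ler01.
  by exists 0; [exact: pos0|rewrite !subrr normr0 mulr0].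
have S1 : ubound S 1 by move=> t [/andP[]].
have hS : has_sup S by split; [exists 0|exists 1].
set s := sup S.
have s01 : 0 <= s <= 1.
  by rewrite (ub_le_sup _ S0) ?ge_sup//; [exact: hS.1|exists 1].
have [d d0 dP] := local s s01.
have [a [a01 ga] sa] := sup_adherent d0 hS.
have as_ : a <= s by apply: ub_le_sup; [exists 1|split].
(* If [1 < s + d], the segment from [a] to 1 is good and ends the proof. Otherwise [s + d / 2] would
   belong to [S] and exceed its supremum. *)
have [s1|s1] := leP (s + d) 1; last first.
  by apply: good_trans ga _; apply: dP => //; case/andP: s01.
have : S (s + d / 2).
  split; first by lra.
  by apply: good_trans ga _; apply: dP => //; lra.
move=> /(ub_le_sup hS.2); rewrite -/s; lra.
Qed.

End MeanValue.

(** * The differential criterion for strong subadditivity *)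

Section Subadditive.
Context {R : realType} {E F : orderedBanach R}.
Implicit Type Phi : E -> F.

Lemma subadditive_diff_le Phi (u v : E) : strongly_subadditive Phi ->
  pos E u -> differentiable Phi u -> differentiable Phi v -> u <=c v ->
  op_le ('d Phi v) ('d Phi u).
Proof.
move=> [_ sub] pu du dv uv w pw.
rewrite /cone_le -!deriveE//.
pose q (a : E) (h : R) := h^-1 *: ((Phi \o shift a) (h *: w) - Phi a).
apply: (@pos_cvg_right _ _ (fun h => q u h - q v h)).
  move=> h h0; rewrite /q /= -scalerBr; apply: posZ.
    by rewrite invr_ge0 ltW.
  (* This instance reads [Phi (v + h *: w) + Phi u <=c Phi v + Phi (u + h *: w)]; it needs [h *: w]
     in the cone, hence the limit from the right. *)
  have := sub (v - u) (h *: w) u uv (posZ (ltW h0) pw) pu.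
  rewrite /cone_le [v - u + h *: w + u]addrAC !subrK [h *: w + v]addrC.
  by rewrite opprB [Phi v + _]addrC addrACA -opprD [Phi u + _]addrC.
by apply: cvgB; apply: cvg_dnbhs_at_right; exact: diff_derivable.
Qed.

Lemma diff_le_subadditive Phi : (pos E)° !=set0 ->
  {within pos E, continuous Phi} ->
  (forall u, (pos E)° u -> differentiable Phi u) ->
  0 <=c Phi 0 ->
  (forall u v : E, (pos E)° u -> (pos E)° v -> u <=c v ->
     op_le ('d Phi v) ('d Phi u)) ->
  strongly_subadditive Phi.
Proof.
move=> [e ie] hcont hdiff Phi0 mono.
have pe := interior_subset ie.
have int x y z : pos E x -> pos E y -> (pos E)° z ->
    Phi (x + y + z) + Phi z <=c Phi (x + z) + Phi (y + z).
  move=> px py iz.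
  (* The increment of [G] from [z] to [z + y] is exactly the difference of the two sides of the
     goal. *)
  pose G w := Phi w - Phi (x + w).
  have iT t : 0 <= t <= 1 -> (pos E)° (z + t *: y).
    move=> /andP[t0 _]; rewrite addrC; apply: interior_posD => //.
    exact: posZ.
  have dT t : 0 <= t <= 1 -> is_derive (z + t *: y) y G
     ('d Phi (z + t *: y) y - 'd Phi (x + (z + t *: y)) y).
    move=> t01; have i1 := iT t t01.
    have i2 := interior_posD _ _ px i1.
    apply: is_deriveB; last apply: is_derive_shift.
      by rewrite -deriveE; [apply/derivableP/diff_derivable|]; exact: hdiff.
    by rewrite -deriveE; [apply/derivableP/diff_derivable|]; exact: hdiff.
  have h := @pos_increment _ _ _ G z y.
  rewrite /G opprB addrACA -opprD in h.
  rewrite /cone_le -[x + y + z]addrA [y + z]addrC [Phi (x + z) + _]addrC.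
  apply: h => t t01; first by have [] := dT t t01.
  have [_ ->] := dT t t01.
  (* The derivative of [G] along [y] is positive because [z + t *: y <=c x + (z + t *: y)], both
     points being interior. *)
  apply: mono => //; [exact: iT|exact/interior_posD/iT|].
  by rewrite /cone_le addrK.
have main x y z : pos E x -> pos E y -> pos E z ->
    Phi (x + y + z) + Phi z <=c Phi (x + z) + Phi (y + z).
  move=> px py pz.
  have c p : pos E p -> Phi (p + h *: e) @[h --> 0^'+] --> Phi p.
    by move=> pp; exact: within_pos_cvg_ray.
  rewrite /cone_le.
  (* This is [int] with [z] replaced by the interior point [z + h *: e]. *)
  apply: (@pos_cvg_right _ _ (fun h : R =>
      Phi (x + z + h *: e) + Phi (y + z + h *: e)
      - (Phi (x + y + z + h *: e) + Phi (z + h *: e)))).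
    move=> h h0; rewrite -[x + z + _]addrA -[y + z + _]addrA.
    rewrite -[x + y + z + _]addrA; apply: int => //.
    by apply: interior_posD => //; exact: interior_posZ.
  by apply: cvgB; apply: cvgD; apply: c; do ?apply: posD.
split=> // x y px py.
have := main x y 0 px py (pos0 E).
rewrite !addr0 /cone_le => h.
have -> : Phi x + Phi y - Phi (x + y) =
  (Phi x + Phi y - (Phi (x + y) + Phi 0)) + (Phi 0 - 0).
  by rewrite subr0 opprD addrA subrK.
exact: posD.
Qed.

Lemma strongly_subadditiveP Phi : (pos E)° !=set0 ->
  {within pos E, continuous Phi} ->
  (forall u, (pos E)° u -> differentiable Phi u) ->
  strongly_subadditive Phi <->
  0 <=c Phi 0 /\
  (forall u v : E, (pos E)° u -> (pos E)° v -> u <=c v ->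
     op_le ('d Phi v) ('d Phi u)).
Proof.
move=> hE hcont hdiff; split=> [sub|[]]; last exact: diff_le_subadditive.
split=> [|u v iu iv]; last first.
  by apply: subadditive_diff_le; auto; exact: interior_subset.
(* At [x = y = 0] subadditivity gives [Phi 0 <=c Phi 0 + Phi 0]. *)
have := sub.1 0 0 (pos0 E) (pos0 E).
by rewrite /cone_le !addr0 addrK subr0.
Qed.

End Subadditive.

Theorem theorem3 (R : realType) (E F : orderedBanach R)
    (hE : (pos E)° !=set0)
    (Phi : E -> F)
    (hcont : {within pos E, continuous Phi})
    (hdiff : forall u : E, (pos E)° u -> differentiable Phi u) :
  (strongly_subadditive Phi <->
     0 <=c Phi 0 /\
     (forall u v : E, (pos E)° u -> (pos E)° v -> u <=c v ->
        op_le ('d Phi v) ('d Phi u))) /\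
  (strongly_superadditive Phi <->
     Phi 0 <=c 0 /\
     (forall u v : E, (pos E)° u -> (pos E)° v -> u <=c v ->
        op_le ('d Phi u) ('d Phi v))).
Proof.
split; first exact: strongly_subadditiveP.
have hcontN : {within pos E, continuous (- Phi)}.
  by move=> x; apply: cvgN; exact: hcont.
have hdiffN u : (pos E)° u -> differentiable (- Phi) u.
  by move=> iu; apply: differentiableN; exact: hdiff.
(* The superadditive case is the subadditive one for [- Phi], whose differential is the opposite
   one, so the operator order is reversed. *)
have op_leN u v : (pos E)° u -> (pos E)° v ->
    op_le ('d (- Phi) v) ('d (- Phi) u) <-> op_le ('d Phi u) ('d Phi v).
  move=> iu iv; split=> H w /H; rewrite /cone_le !diffN; do ?exact: hdiff.
    by rewrite opprK addrC.
  by rewrite opprK addrC.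
apply: iff_trans (strongly_subadditiveP _ hE hcontN hdiffN) _.
rewrite /cone_le subr0 sub0r.
split=> -[H0 H]; split=> // u v iu iv uv; apply/(op_leN u v iu iv); exact: H.
Qed.
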